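(* For any given user grouping $\{\mathcal{U}^{m,g}\}_{m\in\mathcal{M},g\in\mathcal{G}}$: to minimize the total transmit power $P_t=\sum_{m\in\mathcal{M}}\sum_{g\in\mathcal{G}}\sum_{n\in\mathcal{U}^{m,g}}p_n$ while satisfying the QoS requirement $R_n\ge r_n$ of each user $n\in\mathcal{N}$, the optimal SIC decoding order in each group $mg$ is the ascending order of $$S^{m,g}_n=\frac{|H^{m,g}_n|^2}{I_n+\sigma^2},\qquad n\in\mathcal{U}^{m,g}$$ (users with smaller $S^{m,g}_n$ are decoded first), and power should be allocated to each user in group $mg$, in descending order of $S^{m,g}_n$, according to $$p_n=(2^{r_n}-1)\Big(\frac{I_n+\sigma^2}{|H^{m,g}_n|^2}+\sum_{i\in\mathcal{U}^{m,g}:\ S^{m,g}_i>S^{m,g}_n}p_i\Big),\qquad n\in\mathcal{N},$$ where $mg$ is the group containing $n$.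
   Context: System: $\mathcal{M}=\{1,\dots,M\}$ is the set of base stations (BSs), $\mathcal{N}=\{1,\dots,N\}$ the set of users, $\mathcal{G}=\{1,\dots,G\}$ the set of mutually orthogonal channels, each available in every BS. A user grouping assigns every user to exactly one group: the sets $\mathcal{U}^{m,g}$, $m\in\mathcal{M}$, $g\in\mathcal{G}$, are disjoint with union $\mathcal{N}$, and $\mathcal{U}^{m,g}$ (group $mg$) is the set of users served by BS $m$ on channel $g$. $H^{m,g}_n$ is the channel coefficient between BS $m$ and user $n$ on channel $g$; $\sigma^2$ is the noise power; $r_n$ is the target data rate of user $n$; $p_n$ is the transmit power allocated to user $n$. Inter-cell interference: for $n\in\mathcal{U}^{m,g}$, $$I_n=\sum_{m'\in\mathcal{M}\setminus\{m\}}|H^{m',g}_n|^2\sum_{j\in\mathcal{U}^{m',g}}p_j .$$ Successive interference cancellation (SIC): in each group a decoding order of its users is chosen. A user must decode the signals of all users that precede it in the order before decoding its own. When user $i$ decodes the signal of user $n$ of the same group $mg$ (with $i=n$ or $i$ after $n$ in the order), the signals of all users after $n$ in the order act as interference, so the rate at which $i$ can decode the signal of $n$ is $$R_{i\dashrightarrow n}=\log_2\Big(1+\frac{|H^{m,g}_i|^2p_n}{|H^{m,g}_i|^2\sum_{j\in\mathcal{U}^{m,g},\ j\text{ after }n}p_j+I_i+\sigma^2}\Big).$$ The achievable data rate of user $n$ is $R_n=\min\{R_{i\dashrightarrow n}: i\in\mathcal{U}^{m,g},\ i=n\text{ or } i\text{ after }n\}$. The QoS requirement of user $n$ is $R_n\ge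 r_n$.
   Formalization: If users of a group have equal S, the sum in the power formula also includes those decoded later (the literal formula then violates QoS); an optimum is claimed only when the QoS requirements can be met, and the ascending order is the only optimal one only if all target rates are positive. *)

(* Defs.v *)
From HB Require Import structures.
From mathcomp Require Import all_boot all_order all_algebra.
From mathcomp Require Import complex.
From mathcomp Require Import all_classical all_reals all_analysis.

Set Implicit Arguments.
Unset Strict Implicit.
Unset Printing Implicit Defensive.

Import Order.TTheory GRing.Theory Num.Theory.

Local Open Scope ring_scope.

Definition log2 (R : realType) (x : R) : R := ln x / ln 2.

Section PowerMinimization.

Variables (R : realType) (M N G : nat).

(* |z|^2; `|z| lives in R[i], whereas normc is R-valued. *)
Definition gain (z : R[i]) : R := Normc.normc z ^+ 2.

Variables (H : 'I_M -> 'I_G -> 'I_N -> R[i]) (sigma2 : R) (r : 'I_N -> R).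
Variable U : 'I_M -> 'I_G -> {set 'I_N}.

Definition user_grouping : Prop :=
  (forall n, exists m g, n \in U m g) /\
  (forall m g m' g' n, n \in U m g -> n \in U m' g' -> m = m' /\ g = g').

(* I_n, meant for n in U m g. *)
Definition interference (p : 'I_N -> R) (m : 'I_M) (g : 'I_G) (n : 'I_N) : R :=
  \sum_(m' < M | m' != m) gain (H m' g n) * \sum_(j in U m' g) p j.

(* One decoding order per group: d m g lists the users of group mg,
   the first element being decoded first. *)
Definition decoding_order (d : 'I_M -> 'I_G -> seq 'I_N) : Prop :=
  forall m g, uniq (d m g) /\ d m g =i U m g.

Definition after (s : seq 'I_N) (n j : 'I_N) : bool :=
  (index n s < index j s)%N.

(* Rate at which user i decodes the signal of user n, both in group mg. *)
Definition decode_rate (p : 'I_N -> R) (d : 'I_M -> 'I_G -> seq 'I_N)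
    (m : 'I_M) (g : 'I_G) (i n : 'I_N) : R :=
  log2 (1 + gain (H m g i) * p n /
    (gain (H m g i) * (\sum_(j in U m g | after (d m g) n j) p j)
     + interference p m g i + sigma2)).

(* The default value of the iterated minimum, at i = n, is itself one of the
   values of which the minimum is taken. *)
Definition rate (p : 'I_N -> R) (d : 'I_M -> 'I_G -> seq 'I_N)
    (m : 'I_M) (g : 'I_G) (n : 'I_N) : R :=
  \big[Num.min/decode_rate p d m g n n]_(i in U m g |
      (i == n) || after (d m g) n i) decode_rate p d m g i n.

Definition total_power (p : 'I_N -> R) : R :=
  \sum_(m < M) \sum_(g < G) \sum_(n in U m g) p n.

Definition feasible (p : 'I_N -> R) (d : 'I_M -> 'I_G -> seq 'I_N) : Prop :=
  [/\ forall n, 0 <= p n,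
      decoding_order d
    & forall m g n, n \in U m g -> r n <= rate p d m g n].

(* Powers and decoding orders are optimized jointly. *)
Definition optimal (p : 'I_N -> R) (d : 'I_M -> 'I_G -> seq 'I_N) : Prop :=
  feasible p d /\
  forall p' d', feasible p' d' -> total_power p <= total_power p'.

Definition S_val (p : 'I_N -> R) (m : 'I_M) (g : 'I_G) (n : 'I_N) : R :=
  gain (H m g n) / (interference p m g n + sigma2).

Definition ascending_order (p : 'I_N -> R)
    (d : 'I_M -> 'I_G -> seq 'I_N) : Prop :=
  forall m g, sorted (fun n i => S_val p m g n <= S_val p m g i) (d m g).

(* The sum ranges over the users of the group with a larger S.  If several
   users of a group have the same S, the sum over strictly larger S alone would
   ignore the interference between them and violate the QoS constraints; such
   users are compared by the decoding order. When the values of S in a group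
   are pairwise distinct the second alternative only allows i = n, which
   `after` excludes. *)
Definition power_allocation (p : 'I_N -> R)
    (d : 'I_M -> 'I_G -> seq 'I_N) : Prop :=
  forall m g n, n \in U m g ->
    p n = (2 `^ r n - 1) *
      ((interference p m g n + sigma2) / gain (H m g n) +
       \sum_(i in U m g | (S_val p m g n < S_val p m g i) ||
           ((S_val p m g n == S_val p m g i) && after (d m g) n i)) p i).

End PowerMinimization.

(* Main.v *)
(* Write N_n = (I_n + sigma^2) / |H_n|^2 = 1 / S_n.  The interference, hence N,
   depends on the powers only through the total power Q of each group.  For
   fixed N, serving a group in a given order costs at least the value computed
   by p_n = (2^{r_n} - 1) (N_n + sum of the later p_j), and exchanging neighbours
   shows that this value is least when N is decreasing along the order.  So a
   feasible allocation yields Q with F(Q) <= Q, where F, a minimum over decoding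
   orders of affine maps with nonnegative coefficients, is monotone, and
   sigma^2 > 0 makes it strictly subhomogeneous.  Tarski's theorem gives a least
   solution of F(Q) = Q, subhomogeneity puts every greedy solution below every
   feasible one, and an optimal allocation must attain equality in the bound of
   each group, which forces the formula and the order. *)
Require Import Defs.
From HB Require Import structures.
From mathcomp Require Import all_boot all_order all_algebra.
From mathcomp Require Import complex.
From mathcomp Require Import all_classical all_reals all_analysis.
From mathcomp Require Import ring lra.

Import Order.TTheory GRing.Theory Num.Theory.

Local Open Scope ring_scope.

(** * One group with its noise held fixed *)

Section SingleGroup.

Set Implicit Arguments.
Unset Strict Implicit.

Variables (R : realFieldType) (T : eqType) (c : T -> R).
Hypothesis c_ge0 : forall n, 0 <= c n.
Implicit Types (v p : T -> R) (s t u : seq T) (k : R).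

(* Total power of a group whose users, of normalised noise v, are decoded in the
   order s, if each user gets c n times its noise plus the later powers. *)
Definition chain_power v s : R :=
  foldr (fun n x => (1 + c n) * x + c n * v n) 0 s.

Lemma chain_power_ge0 v s :
  (forall n, n \in s -> 0 <= v n) -> 0 <= chain_power v s.
Proof.
elim: s => //= n s IH v_ge0; rewrite addr_ge0 ?mulr_ge0 ?addr_ge0 ?c_ge0 //.
  by apply: IH => i si; rewrite v_ge0 // inE si orbT.
by rewrite v_ge0 ?mem_head.
Qed.

Lemma ler_chain_power v1 v2 s :
  (forall n, n \in s -> v1 n <= v2 n) -> chain_power v1 s <= chain_power v2 s.
Proof.
elim: s => //= n s IH v12; apply: lerD; apply: ler_wpM2l.
- by rewrite addr_ge0.
- by apply: IH => i si; rewrite v12 // inE si orbT.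
- exact: c_ge0.
- by rewrite v12 ?mem_head.
Qed.

Lemma ltr_chain_power v1 v2 s :
  (forall n, n \in s -> v1 n < v2 n) -> has (fun n => 0 < c n) s ->
  chain_power v1 s < chain_power v2 s.
Proof.
elim: s => //= n s IH v12.
have v12s i : i \in s -> v1 i < v2 i by move=> si; rewrite v12 // inE si orbT.
case/orP => [cn|cs].
  rewrite ler_ltD ?ltr_pM2l ?v12 ?mem_head // ler_wpM2l ?addr_ge0 //.
  by apply: ler_chain_power => i /v12s/ltW.
rewrite ltr_leD ?ler_wpM2l ?c_ge0 ?(ltW (v12 _ (mem_head _ _))) //.
by rewrite ltr_pM2l ?IH // ltr_pwDl.
Qed.

(** Positivity depends on the demands alone, so it can be transferred from one noise to another. *)
Lemma chain_power_gt0 v s : (forall n, n \in s -> 0 < v n) ->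
  (0 < chain_power v s) = has (fun n => 0 < c n) s.
Proof.
move=> v_gt0; apply/idP/idP => [|cs].
  apply: contraTT; rewrite -all_predC -leNgt => /allP c_le0.
  suff -> : chain_power v s = 0 by [].
  elim: s c_le0 {v_gt0} => //= n s IH c_le0.
  have /eqP cn0 : c n == 0.
    by rewrite eq_le c_ge0 andbT leNgt; apply: c_le0; rewrite mem_head.
  by rewrite IH ?cn0 ?mulr0 ?mul0r ?addr0 // => i si; rewrite c_le0 // inE si orbT.
suff <- : chain_power (fun=> 0) s = 0 by apply: ltr_chain_power.
by elim: s {v_gt0 cs} => //= n s ->; rewrite !mulr0 addr0.
Qed.

Lemma chain_powerZ k v s :
  chain_power (fun n => k * v n) s = k * chain_power v s.
Proof. by elim: s => [|n s /= ->]; [rewrite /= mulr0 | ring]. Qed.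

(** Moving [n] in front of a neighbour [a] raises the value by [c n * c a * (v a - v n)], which is
    nonnegative when [n] has the smaller noise. *)
Lemma chain_power_exchange v u n t : (forall i, i \in u -> v n <= v i) ->
  chain_power v (u ++ n :: t) <= chain_power v (n :: u ++ t).
Proof.
elim: u => //= a u IH v_ge.
have va : v n <= v a by rewrite v_ge ?mem_head.
have {IH}/= := IH (fun i ui => v_ge i (mem_behead (s := a :: u) ui)).
move=> /(ler_wpM2l (addr_ge0 ler01 (c_ge0 a))).
have : 0 <= c n * c a * (v a - v n) by rewrite !mulr_ge0 ?subr_ge0.
by set X := chain_power _ _; set Y := chain_power _ _; nra.
Qed.

Lemma sorted_split v u n t :
  sorted (fun a b => v b <= v a) (u ++ n :: t) ->
  (forall i, i \in u -> v n <= v i) /\ (forall i, i \in t -> v i <= v n).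
Proof.
have tr : transitive (fun a b : T => v b <= v a).
  by move=> b a d ba db; exact: le_trans db ba.
rewrite sorted_pairwise // pairwise_cat /= => /and3P[/allrelP h _ /andP[/allP h2 _]].
by split=> [i ui|//]; apply: h; rewrite ?mem_head.
Qed.

(** Induction on [s]: its head is found inside [s'], where all users before it have at least its
    noise. By exchange, moving it to the front of [s'] costs no less, and the tails are compared by
    induction. *)
Lemma chain_power_sorted_min v s s' :
  sorted (fun a b => v b <= v a) s' -> perm_eq s s' ->
  chain_power v s' <= chain_power v s.
Proof.
have tr : transitive (fun a b : T => v b <= v a).
  by move=> b a d ba db; exact: le_trans db ba.
elim: s s' => [|n s IH] s' s's pss'; first by rewrite (size0nil (esym (perm_size pss'))).
have ns' : n \in s' by rewrite -(perm_mem pss') mem_head.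
move: s's pss'; case/splitPr: ns' => u t sut pm.
have pst : perm_eq s (u ++ t).
  by rewrite -(perm_cons n) (perm_trans pm) // perm_sym -cat1s perm_catCA.
have [vu _] := sorted_split sut.
apply: (le_trans (chain_power_exchange _ vu)) => /=.
rewrite lerD2r ler_wpM2l ?addr_ge0 //; apply: IH => //.
apply: subseq_sorted sut => //; apply: cat_subseq => //; exact: subseq_cons.
Qed.

(* c n is 2^{r_n} - 1, and v i, for i ranging over n and the later users, comes
   from the requirement that user i can decode the signal of n. *)
Definition meets_demand v p s := forall u n t, s = u ++ n :: t ->
  forall i, i \in n :: t -> c n * (v i + \sum_(j <- t) p j) <= p n.

Definition tight v p s := forall u n t, s = u ++ n :: t ->
  p n = c n * (v n + \sum_(j <- t) p j).

(** * Demand constraints against the chain value *)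

Lemma meets_demand_behead v p n s :
  meets_demand v p (n :: s) -> meets_demand v p s.
Proof. by move=> h u m t sE; apply: (h (n :: u)); rewrite sE. Qed.

Lemma chain_power_le_sum v p s :
  meets_demand v p s -> chain_power v s <= \sum_(j <- s) p j.
Proof.
elim: s => [|n s IH] h; first by rewrite big_nil.
rewrite big_cons /=; have /= := h [::] n s erefl n (mem_head _ _).
have := ler_wpM2l (addr_ge0 ler01 (c_ge0 n)) (IH (meets_demand_behead h)).
by set X := chain_power _ _; set Y := bigop _ _ _; nra.
Qed.

Lemma tight_sum v p s : tight v p s -> \sum_(j <- s) p j = chain_power v s.
Proof.
elim: s => [|n s IH] h; first by rewrite big_nil.
rewrite big_cons /= {1}(h [::] n s erefl) IH; first by ring.
by move=> u m t sE; apply: (h (n :: u)); rewrite sE.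
Qed.

(** The sum exceeds the chain value by the slack of the head plus [1 + c n] times the excess of the
    tail. Both are nonnegative, so without excess both vanish. *)
Lemma meets_demand_tight v p s : meets_demand v p s ->
  \sum_(j <- s) p j <= chain_power v s -> tight v p s.
Proof.
elim: s => [|n s IH] h; first by move=> _ [].
have hs := meets_demand_behead h.
have := ler_wpM2l (addr_ge0 ler01 (c_ge0 n)) (chain_power_le_sum hs).
have := h [::] n s erefl n (mem_head _ _).
have := chain_power_le_sum hs.
have := c_ge0 n.
rewrite big_cons /= => c0 h1 h2 h3 h4 [|m u] k t [].
  move=> <- <-; apply/eqP; rewrite eq_le h2 andbT.
  by move: h1 h3 h4; set X := chain_power _ _; set Y := bigop _ _ _; nra.
move=> _; apply: IH => //.
by move: h1 h2 h3 h4; set X := chain_power _ _; set Y := bigop _ _ _; nra.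
Qed.

Lemma tight_meets_demand v p s : sorted (fun a b => v b <= v a) s ->
  tight v p s -> meets_demand v p s.
Proof.
move=> ss h u n t sE i; rewrite inE (h _ _ _ sE) => /predU1P[-> //|ti].
move: ss; rewrite sE => /sorted_split[_ /(_ i ti) vi].
by rewrite ler_wpM2l ?lerD2r.
Qed.

(** Powers are fixed from the last user backwards; uniqueness keeps a new head from overwriting a
    later power. *)
Lemma tight_exists v s : uniq s -> exists p, tight v p s.
Proof.
elim: s => [|a s IH] /=; first by exists (fun=> 0); case.
move=> /andP[as_ /IH[p tp]].
exists (fun n => if n == a then c a * (v a + \sum_(j <- s) p j) else p n).
have sum_s t : {subset t <= s} ->
    \sum_(j <- t) (if j == a then c a * (v a + \sum_(j <- s) p j) else p j)
    = \sum_(j <- t) p j.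
  move=> ts; apply: eq_big_seq => j /ts js.
  by case: eqP => // ja; rewrite -ja js in as_.
case=> [|b u] n t [].
  by move=> <- <-; rewrite eqxx sum_s.
move=> _ sE; have /negPf -> : n != a.
  by apply: contraNneq as_ => <-; rewrite sE mem_cat mem_head orbT.
rewrite sum_s -?(tp u n t) //.
by move=> j tj; rewrite sE mem_cat inE tj !orbT.
Qed.

Lemma tight_ge0 v p s : (forall n, n \in s -> 0 <= v n) -> tight v p s ->
  forall n, n \in s -> 0 <= p n.
Proof.
move=> v0 tp n sn; move: v0 tp; case/splitPr: sn => u t v0 tp.
rewrite (tp u n t) // (@tight_sum v p t) => [|w m x tE].
  rewrite mulr_ge0 ?addr_ge0 ?v0 ?mem_cat ?mem_head ?orbT //.
  by apply: chain_power_ge0 => i ti; rewrite v0 // mem_cat inE ti !orbT.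
by apply: (tp (u ++ n :: w)); rewrite tE -catA.
Qed.

(** The later user [i] must also decode [n], whose power is just enough for [n] itself; cancelling
    [c n] compares the two noises. *)
Lemma tight_priority v p s u n t : s = u ++ n :: t ->
  meets_demand v p s -> tight v p s -> 0 < c n ->
  forall i, i \in t -> v i <= v n.
Proof.
move=> sE md tp cn i ti.
have := md u n t sE i; rewrite inE ti orbT => /(_ isT).
by rewrite (tp u n t sE) ler_pM2l // lerD2r.
Qed.

End SingleGroup.

(** * All groups, coupled by interference *)

Section System.

Set Implicit Arguments.
Unset Strict Implicit.

Variables (R : realType) (M N G : nat).
Variables (H : 'I_M -> 'I_G -> 'I_N -> R[i]) (sigma2 : R) (r : 'I_N -> R).
Variable U : 'I_M -> 'I_G -> {set 'I_N}.
Hypothesis sigma2_gt0 : 0 < sigma2.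
Hypothesis r_ge0 : forall n, 0 <= r n.
Hypothesis H_neq0 : forall m g n, n \in U m g -> H m g n != 0.

Implicit Types (p : 'I_N -> R) (d : 'I_M -> 'I_G -> seq 'I_N).
Implicit Types (Q : 'I_M -> 'I_G -> R) (m : 'I_M) (g : 'I_G).

Local Notation c := (fun n => 2 `^ r n - 1).

Definition load p m g : R := \sum_(j in U m g) p j.

(** A function of group totals rather than of user powers, so that the fixed point is sought among
    the totals. *)
Definition noise Q m g n : R :=
  (\sum_(m' < M | m' != m) gain (H m' g n) * Q m' g + sigma2) / gain (H m g n).

Lemma demand_ge0 n : 0 <= c n.
Proof.
by rewrite subr_ge0 -[leLHS](powRr0 2) ler_powR ?ler1n.
Qed.

Lemma gain_ge0 (z : R[i]) : 0 <= gain z.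
Proof. exact: sqr_ge0. Qed.

Lemma gain_gt0 (z : R[i]) : z != 0 -> 0 < gain z.
Proof.
move=> z0; rewrite lt_def gain_ge0 andbT expf_eq0 /=.
by apply: contraNneq z0 => /Normc.eq0_normc ->.
Qed.

Lemma load_ge0 p m g : (forall n, 0 <= p n) -> 0 <= load p m g.
Proof. by move=> p0; apply: sumr_ge0. Qed.

Lemma noise_gt0 Q m g n : (forall m g, 0 <= Q m g) -> n \in U m g ->
  0 < noise Q m g n.
Proof.
move=> Q0 nU; rewrite divr_gt0 ?gain_gt0 ?H_neq0 // ltr_wpDl //.
by apply: sumr_ge0 => m' _; rewrite mulr_ge0 ?gain_ge0.
Qed.

Lemma ler_noise Q1 Q2 m g n : (forall m g, Q1 m g <= Q2 m g) ->
  noise Q1 m g n <= noise Q2 m g n.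
Proof.
move=> Q12; rewrite ler_wpM2r ?invr_ge0 ?gain_ge0 // lerD2r.
by apply: ler_sum => m' _; rewrite ler_wpM2l ?gain_ge0.
Qed.

(* Scaling the powers up does not scale the thermal noise, hence the strict
   inequality. *)
Lemma noise_scale_lt Q1 Q2 k m g n : 1 < k ->
  (forall m g, Q1 m g <= k * Q2 m g) -> n \in U m g ->
  noise Q1 m g n < k * noise Q2 m g n.
Proof.
move=> k1 Q12 nU; rewrite mulrA ltr_pM2r ?invr_gt0 ?gain_gt0 ?H_neq0 //.
rewrite mulrDr ler_ltD ?ltr_pMl // mulr_sumr.
by apply: ler_sum => m' _; rewrite mulrCA ler_wpM2l ?gain_ge0.
Qed.

Lemma interference_noise p m g n :
  (interference H U p m g n + sigma2) / gain (H m g n) = noise (load p) m g n.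
Proof. by []. Qed.

Lemma S_val_noise p m g n : S_val H sigma2 U p m g n = (noise (load p) m g n)^-1.
Proof. by rewrite -interference_noise invf_div. Qed.

Lemma decoding_order_perm d d' m g :
  decoding_order U d -> decoding_order U d' -> perm_eq (d m g) (d' m g).
Proof.
move=> /(_ m g)[ud dU] /(_ m g)[ud' dU']; apply: uniq_perm => // n.
by rewrite dU dU'.
Qed.

Lemma load_seq p d m g : decoding_order U d ->
  load p m g = \sum_(j <- d m g) p j.
Proof.
move=> /(_ m g)[ud dU]; rewrite /load -big_enum; apply: perm_big.
by apply: uniq_perm; rewrite ?enum_uniq // => n; rewrite mem_enum dU.
Qed.

Lemma after_tail (u t : seq 'I_N) n j : uniq (u ++ n :: t) ->
  j \in t -> after (u ++ n :: t) n j.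
Proof.
rewrite cat_uniq /= negb_or => /and3P[uu /andP[nu /hasPn tu] /andP[nt ut]] jt.
rewrite /after !index_cat (negPf nu) (negPf (tu _ jt)) ltn_add2l /= eqxx.
by case: eqP => // nj; rewrite nj jt in nt.
Qed.

Lemma after_head (u t : seq 'I_N) n j : uniq (u ++ n :: t) ->
  j \in u -> after (u ++ n :: t) n j = false.
Proof.
rewrite cat_uniq /= negb_or => /and3P[uu /andP[nu tu] /andP[nt ut]] ju.
rewrite /after !index_cat (negPf nu) ju /= eqxx addn0; apply/negbTE.
by rewrite -leqNgt ltnW // index_mem.
Qed.

(** A general [P] serves both the sum over [after] and the sum over larger [S_val]; in the latter,
    earlier users may be selected, but only with zero power. *)
Lemma sum_tail d m g u n t (P : pred 'I_N) p :
  decoding_order U d -> d m g = u ++ n :: t ->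
  (forall i, i \in u -> P i -> p i = 0) -> ~~ P n -> (forall i, i \in t -> P i) ->
  \sum_(j in U m g | P j) p j = \sum_(j <- t) p j.
Proof.
move=> /(_ m g)[ud dU] dE Pu Pn Pt.
rewrite -big_enum_cond (perm_big (d m g)) /=; last first.
  by apply: uniq_perm; rewrite ?enum_uniq // => i; rewrite mem_enum dU.
rewrite dE big_cat big_cons /= (negPf Pn) big_seq_cond big1 ?add0r.
  by rewrite big_mkcond; apply: eq_big_seq => i /Pt ->.
by move=> i /andP[/Pu].
Qed.

Lemma sum_after d m g u n t p :
  decoding_order U d -> d m g = u ++ n :: t ->
  \sum_(j in U m g | after (d m g) n j) p j = \sum_(j <- t) p j.
Proof.
move=> dec dE; have [ud _] := dec m g; rewrite dE in ud.
apply: (sum_tail dec dE) => [i iu||i it]; rewrite dE.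
- by rewrite after_head.
- by rewrite /after ltnn.
- by rewrite after_tail.
Qed.

(** * Rate constraints as linear inequalities *)

Lemma ler_log2 (a x : R) : 0 < x -> (a <= log2 x) = (2 `^ a <= x).
Proof.
move=> x0; have ln2 : 0 < ln 2 :> R by rewrite ln_gt0 ?ltr1n.
by rewrite /log2 ler_pdivlMr // -ler_expR lnK ?posrE // /powR pnatr_eq0.
Qed.

(** Clearing the logarithm, the denominator and the gain of [i] leaves a condition in which the
    decoder [i] appears only through its noise. *)
Lemma decode_rateP p d m g i n : (forall j, 0 <= p j) ->
  n \in U m g -> i \in U m g ->
  (r n <= decode_rate H sigma2 U p d m g i n) =
  (c n * (noise (load p) m g i + \sum_(j in U m g | after (d m g) n j) p j)
     <= p n).
Proof.
move=> p0 nU iU; rewrite /decode_rate -interference_noise.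
set I := interference _ _ _ _ _ _; set A := \sum_(j in _ | _) _.
have h0 : 0 < gain (H m g i) by rewrite gain_gt0 ?H_neq0.
have A0 : 0 <= A by apply: sumr_ge0.
have I0 : 0 <= I.
  by apply: sumr_ge0 => m' _; rewrite mulr_ge0 ?gain_ge0 ?load_ge0.
have D0 : 0 < gain (H m g i) * A + I + sigma2.
  by rewrite ltr_wpDl // addr_ge0 // mulr_ge0 // ltW.
rewrite ler_log2; last first.
  by apply: ltr_pwDl => //; apply: divr_ge0 (ltW D0); rewrite mulr_ge0 ?gain_ge0.
rewrite addrC -lerBlDr ler_pdivlMr //.
have -> : (I + sigma2) / gain (H m g i) + A =
    (gain (H m g i) * A + I + sigma2) / gain (H m g i).
  by field; rewrite gt_eqF.
by rewrite mulrA ler_pdivrMr // [p n * _]mulrC.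
Qed.

Lemma rateP p d m g n : (forall j, 0 <= p j) -> n \in U m g ->
  reflect (forall i, i \in U m g -> (i == n) || after (d m g) n i ->
     r n <= decode_rate H sigma2 U p d m g i n)
    (r n <= rate H sigma2 U p d m g n).
Proof.
move=> p0 nU; rewrite /rate; apply: (iffP idP) => [/bigmin_geP[_ h] i iU ni|h].
  by apply: h; rewrite iU.
by apply/bigmin_geP; split=> [|i /andP[]]; [apply: h; rewrite ?eqxx | exact: h].
Qed.

(** The users that must decode [n] form the suffix of the list starting at [n], which gives the
    shape of [meets_demand]. *)
Lemma feasibleP p d : feasible H sigma2 r U p d <->
  [/\ forall n, 0 <= p n, decoding_order U d &
      forall m g, meets_demand c (noise (load p) m g) p (d m g)].
Proof.
split=> [[p0 dec ok]|[p0 dec ok]]; split=> // m g.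
  have [ud dU] := dec m g; move=> u n t dE i it.
  have nU : n \in U m g by rewrite -dU dE mem_cat mem_head orbT.
  have iU : i \in U m g by rewrite -dU dE mem_cat it orbT.
  rewrite -(sum_after p dec dE) -decode_rateP //.
  move/rateP: (ok m g n nU) => -> //; rewrite dE in ud *.
  by move: it; rewrite inE => /predU1P[->|it]; [rewrite eqxx | rewrite after_tail ?orbT].
move=> n nU; apply/rateP => // i iU ni; rewrite decode_rateP //.
have [ud dU] := dec m g.
have [u [t dE]] : exists u t, d m g = u ++ n :: t.
  have: n \in d m g by rewrite dU.
  by case/splitPr => u t; exists u, t.
rewrite (sum_after p dec dE); apply: (ok m g u n t dE).
have: i \in d m g by rewrite dU.
rewrite dE mem_cat => /orP[iu|//]; rewrite dE in ud ni.
by rewrite after_head // orbF in ni; rewrite (eqP ni) mem_head.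
Qed.

(** * Comparison of solutions, and the least one *)

(** Let [k] be the largest ratio of [Q1] to [Q2]. If [k > 1], strict subhomogeneity gives
    [Q1 < k * Q2] at the group attaining [k], a contradiction. *)
Lemma supersolution_ge Q1 Q2 d :
  (forall m g, 0 <= Q1 m g) -> (forall m g, 0 <= Q2 m g) ->
  decoding_order U d ->
  (forall m g, Q1 m g <= chain_power c (noise Q1 m g) (d m g)) ->
  (forall m g, chain_power c (noise Q2 m g) (d m g) <= Q2 m g) ->
  forall m g, Q1 m g <= Q2 m g.
Proof.
move=> Q1_ge0 Q2_ge0 dec Q1_le Q2_ge m0 g0; rewrite leNgt; apply/negP => lt0.
have pos m g n Q : (forall m g, 0 <= Q m g) -> n \in d m g -> 0 < noise Q m g n.
  by move=> Q_ge0; rewrite (dec m g).2 => /noise_gt0; apply.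
(* The ratios make sense: where [Q1] is positive some user has positive demand, so [Q2] is positive
   too. *)
have Q2_gt0 m g : 0 < Q1 m g -> 0 < Q2 m g.
  move=> /lt_le_trans/(_ (Q1_le m g)).
  rewrite (chain_power_gt0 demand_ge0); last by move=> n; apply: pos.
  rewrite -(chain_power_gt0 demand_ge0 (v := noise Q2 m g)).
    by move/lt_le_trans; apply.
  by move=> n; apply: pos.
pose f x := Q1 x.1 x.2 / Q2 x.1 x.2.
have [[m g] _ /= f_max] := @arg_maxP _ _ _ (m0, g0) xpredT f isT.
set k := f (m, g) in f_max.
have k1 : 1 < k.
  apply: lt_le_trans (f_max (m0, g0) isT).
  by rewrite /f /= ltr_pdivlMr ?mul1r // Q2_gt0 // (le_lt_trans (Q2_ge0 m0 g0)).
have Q12 m' g' : Q1 m' g' <= k * Q2 m' g'.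
  have [Q20|Q20] := ltP 0 (Q2 m' g').
    by rewrite -ler_pdivrMr //; exact: (f_max (m', g') isT).
  rewrite (le_trans _ (mulr_ge0 (ltW (lt_trans ltr01 k1)) (Q2_ge0 _ _))) //.
  by rewrite leNgt; apply: contraL Q20 => /Q2_gt0; rewrite ltNge.
have Q1mg : 0 < Q1 m g.
  rewrite lt_def Q1_ge0 andbT; apply: contraTneq k1 => Q10.
  by rewrite /k /f /= Q10 mul0r ltr10.
have kE : k * Q2 m g = Q1 m g by rewrite divfK // gt_eqF // Q2_gt0.
(* The noise of [Q1] is strictly below [k] times that of [Q2]; a user of positive demand carries the
   strictness over to the chain value. *)
have: Q1 m g < Q1 m g.
  apply: le_lt_trans (Q1_le m g) _; rewrite -[ltRHS]kE.
  apply: lt_le_trans (_ : k * chain_power c (noise Q2 m g) (d m g) <= _).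
    rewrite -chain_powerZ; apply: ltr_chain_power; first exact: demand_ge0.
      by move=> n; rewrite (dec m g).2 => nU; exact: noise_scale_lt.
    rewrite -(chain_power_gt0 demand_ge0 (v := noise Q1 m g)).
      exact: lt_le_trans (Q1_le m g).
    by move=> n; apply: pos.
  by rewrite ler_wpM2l // ltW // (lt_trans ltr01).
by rewrite ltxx.
Qed.

Definition greedy_order Q m g : seq 'I_N :=
  sort (fun a b => noise Q m g b <= noise Q m g a) (enum (U m g)).

Lemma greedy_order_decoding Q : decoding_order U (greedy_order Q).
Proof.
move=> m g; rewrite sort_uniq enum_uniq; split=> // n.
by rewrite mem_sort mem_enum.
Qed.

Lemma greedy_order_sorted Q m g :
  sorted (fun a b => noise Q m g b <= noise Q m g a) (greedy_order Q m g).
Proof. by apply: sort_sorted => a b; exact: le_total. Qed.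

(* Tarski's fixed point theorem: the componentwise infimum of all
   supersolutions is a solution. *)
Lemma least_solution_exists Q0 d0 :
  (forall m g, 0 <= Q0 m g) -> decoding_order U d0 ->
  (forall m g, chain_power c (noise Q0 m g) (d0 m g) <= Q0 m g) ->
  exists2 Q, (forall m g, 0 <= Q m g) &
    forall m g, chain_power c (noise Q m g) (greedy_order Q m g) = Q m g.
Proof.
move=> Q0_ge0 dec0 Q0_super.
(* Each supersolution brings its own orders, which expresses [F(Q) <= Q] for a minimum [F] over
   orders. *)
pose X : set ('I_M -> 'I_G -> R) := [set Q | (forall m g, 0 <= Q m g) /\
  exists2 d, decoding_order U d &
    forall m g, chain_power c (noise Q m g) (d m g) <= Q m g]%classic.
pose Qs m g := inf [set Q m g | Q in X]%classic.
have X0 m g : ([set Q m g | Q in X] !=set0)%classic.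
  by exists (Q0 m g), Q0 => //; split=> //; exists d0.
have XQs Q m g : X Q -> Qs m g <= Q m g.
  move=> XQ; apply: ge_inf; last by exists Q.
  by exists 0 => _ [Q' [Q'0 _] <-].
have Qs_ge0 m g : 0 <= Qs m g.
  by apply: lb_le_inf => // _ [Q' [Q'0 _] <-].
(* This is [F] at the infimum [Qs]. By monotonicity it lies below every supersolution, hence below
   [Qs]; it is then itself a supersolution, hence above [Qs]. *)
pose Q m g := chain_power c (noise Qs m g) (greedy_order Qs m g).
have Q_le m g : Q m g <= Qs m g.
  apply: lb_le_inf => // _ [Q' XQ' <-]; have [Q'0 [d dec Q'd]] := XQ'.
  apply: le_trans (Q'd m g).
  apply: le_trans (_ : chain_power c (noise Qs m g) (d m g) <= _).
    apply: chain_power_sorted_min; first exact: demand_ge0.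
      exact: greedy_order_sorted.
    exact/decoding_order_perm/greedy_order_decoding.
  apply: ler_chain_power => [|n _]; first exact: demand_ge0.
  by apply: ler_noise => m' g'; exact: XQs.
have Q_ge m g : Qs m g <= Q m g.
  apply: XQs; split=> [m' g'|].
    apply: chain_power_ge0 => [|n]; first exact: demand_ge0.
    by rewrite (greedy_order_decoding Qs m' g').2 => /noise_gt0-/(_ _ Qs_ge0)/ltW.
  exists (greedy_order Qs) => [|m' g']; first exact: greedy_order_decoding.
  apply: ler_chain_power => [|n _]; first exact: demand_ge0.
  exact: ler_noise.
by exists Qs => // m g; apply/eqP; rewrite eq_le Q_le Q_ge.
Qed.

(** The load of a feasible [p'] is a supersolution for [d']. The greedy load is a subsolution for
    the same [d'], since sorting by its own noise is cheapest. *)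
Lemma greedy_solution_least p d : (forall n, 0 <= p n) -> decoding_order U d ->
  (forall m g, sorted (fun a b => noise (load p) m g b <= noise (load p) m g a)
     (d m g)) ->
  (forall m g, tight c (noise (load p) m g) p (d m g)) ->
  feasible H sigma2 r U p d /\
  forall p' d', feasible H sigma2 r U p' d' ->
    forall m g, load p m g <= load p' m g.
Proof.
move=> p0 dec srt tgt; split.
  apply/feasibleP; split=> // m g.
  by apply: tight_meets_demand => //; exact: demand_ge0.
move=> p' d' /feasibleP[p'0 dec' md'].
apply: (@supersolution_ge _ _ d') => // m g; try exact: load_ge0.
  rewrite (load_seq _ _ _ dec) (tight_sum (tgt m g)).
  apply: chain_power_sorted_min => //; first exact: demand_ge0.
  exact: decoding_order_perm.
rewrite (load_seq _ _ _ dec'); apply: chain_power_le_sum => //.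
exact: demand_ge0.
Qed.

Lemma ler_total_power p p' : (forall m g, load p m g <= load p' m g) ->
  total_power U p <= total_power U p'.
Proof. by move=> h; apply: ler_sum => m _; apply: ler_sum => g _; apply: h. Qed.

(** * The order and the power formula in terms of noise *)

Lemma ascending_orderP p d : (forall n, 0 <= p n) -> decoding_order U d ->
  ascending_order H sigma2 U p d <->
  (forall m g, sorted (fun a b => noise (load p) m g b <= noise (load p) m g a)
     (d m g)).
Proof.
move=> p0 dec.
suff E m g : sorted (fun n i => S_val H sigma2 U p m g n <= S_val H sigma2 U p m g i) (d m g)
  = sorted (fun a b => noise (load p) m g b <= noise (load p) m g a) (d m g).
  by split=> h m g; have := h m g; rewrite E.
apply: (@eq_in_sorted _ (mem (d m g))); last exact/allP.
move=> a b ad bd; rewrite !S_val_noise lef_pV2 // posrE noise_gt0 //.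
- by move=> *; exact: load_ge0.
- by rewrite -(dec m g).2.
- by move=> *; exact: load_ge0.
- by rewrite -(dec m g).2.
Qed.

(** Ties in noise are settled by [after], so all of [t] is selected; a user of [u] is selected only
    if its noise is strictly smaller, and then has zero power. *)
Lemma priority_sum p d m g u n t : (forall n, 0 <= p n) -> decoding_order U d ->
  d m g = u ++ n :: t ->
  (forall i, i \in t -> noise (load p) m g i <= noise (load p) m g n) ->
  (forall i, i \in u -> noise (load p) m g i < noise (load p) m g n -> p i = 0) ->
  \sum_(i in U m g | (S_val H sigma2 U p m g n < S_val H sigma2 U p m g i) ||
     ((S_val H sigma2 U p m g n == S_val H sigma2 U p m g i)
        && after (d m g) n i)) p i
  = \sum_(j <- t) p j.
Proof.
move=> p0 dec dE tn un.
have [ud dU] := dec m g.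
have pos i : i \in d m g -> 0 < noise (load p) m g i.
  by rewrite dU => /noise_gt0; apply=> *; exact: load_ge0.
have nd : n \in d m g by rewrite dE mem_cat mem_head orbT.
have Slt i : i \in d m g -> (S_val H sigma2 U p m g n < S_val H sigma2 U p m g i)
    = (noise (load p) m g i < noise (load p) m g n).
  by move=> id; rewrite !S_val_noise ltf_pV2 // posrE pos.
have Seq i : (S_val H sigma2 U p m g n == S_val H sigma2 U p m g i)
    = (noise (load p) m g n == noise (load p) m g i).
  by rewrite !S_val_noise (inj_eq invr_inj).
apply: (sum_tail dec dE) => [i iu||i it].
- rewrite Slt ?dE ?mem_cat ?iu // after_head -?dE // andbF orbF.
  exact: un.
- by rewrite ltxx /after ltnn andbF.
- rewrite Slt ?dE ?mem_cat ?inE ?it ?orbT // after_tail -?dE // andbT Seq.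
  by rewrite eq_sym orbC -le_eqVlt tn.
Qed.

(** By [tight_priority], an earlier user of strictly smaller noise has zero demand, hence zero
    power. If [c n = 0], both sides vanish. *)
Lemma tight_power_allocation p d : feasible H sigma2 r U p d ->
  (forall m g, tight c (noise (load p) m g) p (d m g)) ->
  power_allocation H sigma2 r U p d.
Proof.
move=> /feasibleP[p0 dec md] tgt m g n nU.
have [u [t dE]] : exists u t, d m g = u ++ n :: t.
  have: n \in d m g by rewrite (dec m g).2.
  by case/splitPr => u t; exists u, t.
have pn := tgt m g u n t dE.
have [cn|cn] := ltP 0 (c n); last first.
  have cn0 : c n = 0 by apply/eqP; rewrite eq_le cn demand_ge0.
  by rewrite pn /= cn0 !mul0r.
rewrite (priority_sum p0 dec dE) // => [|i iu lt_in].
  exact: (tight_priority dE (md m g) (tgt m g) cn).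
have [u1 [u2 uE]] : exists u1 u2, u = u1 ++ i :: u2.
  by case/splitPr: iu => u1 u2; exists u1, u2.
have dEi : d m g = u1 ++ i :: (u2 ++ n :: t) by rewrite dE uE -catA.
have [ci|ci] := ltP 0 (c i).
  have := tight_priority dEi (md m g) (tgt m g) ci (i := n).
  by rewrite mem_cat mem_head orbT leNgt lt_in => /(_ isT).
have ci0 : c i = 0 by apply/eqP; rewrite eq_le ci demand_ge0.
by rewrite (tgt m g _ _ _ dEi) /= ci0 mul0r.
Qed.

Lemma power_allocation_tight p d : (forall n, 0 <= p n) -> decoding_order U d ->
  (forall m g, sorted (fun a b => noise (load p) m g b <= noise (load p) m g a)
     (d m g)) ->
  power_allocation H sigma2 r U p d ->
  forall m g, tight c (noise (load p) m g) p (d m g).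
Proof.
move=> p0 dec srt pa m g u n t dE.
have nU : n \in U m g by rewrite -(dec m g).2 dE mem_cat mem_head orbT.
have := srt m g; rewrite dE => /sorted_split[un tn].
rewrite {1}(pa m g n nU) (priority_sum p0 dec dE) // => i /un.
by rewrite leNgt => /negPf ->.
Qed.

(** * Existence of a greedy allocation, tightness of optimal ones *)

Hypothesis U_grouping : user_grouping U.

Lemma greedy_solution_exists p0 d0 : feasible H sigma2 r U p0 d0 ->
  exists p d, [/\ forall n, 0 <= p n, decoding_order U d,
    forall m g, sorted (fun a b => noise (load p) m g b <= noise (load p) m g a)
     (d m g) & forall m g, tight c (noise (load p) m g) p (d m g)].
Proof.
move=> /feasibleP[p0_ge0 dec0 md0].
have [||Q Q0 QE] := @least_solution_exists (load p0) d0 _ dec0.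
- by move=> m g; exact: load_ge0.
- move=> m g; rewrite (load_seq _ _ _ dec0).
  by apply: chain_power_le_sum => //; exact: demand_ge0.
have dec := greedy_order_decoding Q.
have /choice[q q_tight] (x : 'I_M * 'I_G) : exists q,
    tight c (noise Q x.1 x.2) q (greedy_order Q x.1 x.2).
  exact: tight_exists (dec x.1 x.2).1.
(* Each user lies in exactly one group, so the powers chosen group by group glue together. *)
have /choice[grp grpP] n : exists x : 'I_M * 'I_G, n \in U x.1 x.2.
  by have [m [g nU]] := U_grouping.1 n; exists (m, g).
pose p n := q (grp n) n.
have pE m g n : n \in greedy_order Q m g -> p n = q (m, g) n.
  rewrite (dec m g).2 => nU; rewrite /p.
  have := grpP n; case: (grp n) => m' g' /= nU'.
  by have [-> ->] := U_grouping.2 _ _ _ _ _ nU nU'.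
have p_tight m g : tight c (noise Q m g) p (greedy_order Q m g).
  move=> u n t dE; rewrite (pE m g) ?dE ?mem_cat ?mem_head ?orbT //.
  rewrite (q_tight (m, g) u n t dE); congr (_ * (_ + _)).
  by apply: eq_big_seq => j jt; rewrite (pE m g) // dE mem_cat inE jt !orbT.
(* The powers were built for the noise of [Q]; the fixed point equation makes it their actual
   noise. *)
have loadE : load p = Q.
  apply/funext => m; apply/funext => g.
  by rewrite (load_seq _ _ _ dec) (tight_sum (p_tight m g)) QE.
exists p, (greedy_order Q); rewrite loadE; split=> // [n|m g].
  have nd : n \in greedy_order Q (grp n).1 (grp n).2 by rewrite (dec _ _).2.
  apply: tight_ge0 (p_tight _ _) _ nd; first exact: demand_ge0.
  by move=> i; rewrite (dec _ _).2 => /noise_gt0-/(_ _ Q0)/ltW.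
exact: greedy_order_sorted.
Qed.

Lemma optimal_tight p d : optimal H sigma2 r U p d ->
  forall m g, tight c (noise (load p) m g) p (d m g).
Proof.
move=> [fs opt]; have [q [e [q0 dece srt tgt]]] := greedy_solution_exists fs.
have [fsq leq] := greedy_solution_least q0 dece srt tgt.
have le_qp := leq _ _ fs.
have loadE : load q = load p.
  apply/funext => m; apply/funext => g.
  (* One group with strictly smaller load under [q], none being larger, would contradict the
     optimality of [p]. *)
  have := opt _ _ fsq; rewrite leNgt.
  apply: contraNeq => neq; rewrite /total_power.
  rewrite (bigD1 m) //= (bigD1 g) //= [ltRHS](bigD1 m) //=.
  rewrite [in ltRHS](bigD1 g) //= -!addrA.
  rewrite ltr_leD ?lt_neqAle ?neq ?le_qp //.
  apply: lerD; first by apply: ler_sum => g' _; exact: le_qp.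
  by apply: ler_sum => m' _; apply: ler_sum => g' _; exact: le_qp.
have /feasibleP[p0 dec md] := fs.
move=> m g; apply: meets_demand_tight => //; first exact: demand_ge0.
rewrite -(load_seq _ _ _ dec) -loadE (load_seq _ _ _ dece) (tight_sum (tgt m g)).
apply: chain_power_sorted_min => //; first exact: demand_ge0.
exact: decoding_order_perm.
Qed.

End System.

Theorem theorem1 (R : realType) (M N G : nat)
    (H : 'I_M -> 'I_G -> 'I_N -> R[i]) (sigma2 : R) (r : 'I_N -> R)
    (U : 'I_M -> 'I_G -> {set 'I_N})
    (sigma2_gt0 : 0 < sigma2)
    (r_ge0 : forall n, 0 <= r n)
    (U_grouping : user_grouping U)
    (H_neq0 : forall m g n, n \in U m g -> H m g n != 0) :
  [/\ (exists p d, feasible H sigma2 r U p d) ->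
        exists p d, [/\ optimal H sigma2 r U p d,
                        ascending_order H sigma2 U p d
                      & power_allocation H sigma2 r U p d],
      forall (p : 'I_N -> R) d, (forall n, 0 <= p n) -> decoding_order U d ->
        ascending_order H sigma2 U p d ->
        power_allocation H sigma2 r U p d ->
        optimal H sigma2 r U p d
    & forall p d, optimal H sigma2 r U p d ->
        power_allocation H sigma2 r U p d /\
        ((forall n, 0 < r n) -> ascending_order H sigma2 U p d)].
Proof.
have greedy_optimal p d : (forall n, 0 <= p n) -> decoding_order U d ->
    ascending_order H sigma2 U p d -> power_allocation H sigma2 r U p d ->
    optimal H sigma2 r U p d.
  move=> p0 dec /ascending_orderP srt pa.
  have {}srt := srt sigma2_gt0 H_neq0 p0 dec.
  have tgt := power_allocation_tight sigma2_gt0 H_neq0 p0 dec srt pa.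
  have [fs least] := greedy_solution_least sigma2_gt0 r_ge0 H_neq0 p0 dec srt tgt.
  by split=> // p' d' /least; exact: ler_total_power.
split=> [[p0 [d0 fs0]]|//|p d opt].
  have [p [d [p_ge0 dec srt tgt]]] :=
    greedy_solution_exists sigma2_gt0 r_ge0 H_neq0 U_grouping fs0.
  have asc : ascending_order H sigma2 U p d by apply/ascending_orderP.
  have [fs _] := greedy_solution_least sigma2_gt0 r_ge0 H_neq0 p_ge0 dec srt tgt.
  have pa := tight_power_allocation sigma2_gt0 r_ge0 H_neq0 fs tgt.
  by exists p, d; split=> //; exact: greedy_optimal.
have tgt := optimal_tight sigma2_gt0 r_ge0 H_neq0 U_grouping opt.
have [fs _] := opt.
split; first exact: tight_power_allocation tgt.
(* Positive rates give positive demands, so [tight_priority] compares each user with all later ones;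
   a user of zero demand would impose nothing on those after it. *)
move=> r_gt0; have /feasibleP[] := fs => // p0 dec md.
apply/ascending_orderP => // m g.
have c_gt0 n : 0 < 2 `^ r n - 1.
  by rewrite subr_gt0 /powR pnatr_eq0 /= -[ltLHS]expR0 ltr_expR mulr_gt0 ?ln_gt0 ?ltr1n.
have := md m g; have := tgt m g.
elim: (d m g) => // n s IH tgt_s md_s.
rewrite /= path_sortedE; last by move=> a b x ba ax; exact: le_trans ax ba.
apply/andP; split; last first.
  apply: IH; last exact: meets_demand_behead md_s.
  by move=> u i t sE; apply: (tgt_s (n :: u)); rewrite sE.
apply/allP => i si.
exact: (tight_priority (u := [::]) erefl md_s tgt_s).
Qed.
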